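(* Let $f:\mathbb{R}^d\to\mathbb{R}$ be $L$-smooth with $L>0$ and $f_*=\inf_x f(x)>-\infty$. Let $\{x^t\},\{g^t\}$ be generated by the scheme $x^{t+1}=x^t-\gamma_t g^t$ ($t=0,1,\dots$), and suppose that the Unified Assumption (see context) holds with constants $A,B,C\ge 0$, $\rho_1,\rho_2\in(0,1]$ and a non-negative random sequence $\{\sigma_t^2\}$. If the step size is constant, $\gamma_t\equiv\gamma>0$, with $$\gamma\le\frac1L\left(1+\sqrt{\frac{B\rho_2+AC}{\rho_1\rho_2}}\right)^{-1},$$ then for every integer $T>0$ $$\frac1T\sum_{t=0}^{T-1}\mathbb{E}\|\nabla f(x^t)\|^2\le\frac{2V^0}{\gamma T},$$ where $$V^0=\mathbb{E}\left[f(x^0)-f_*+\frac{\gamma}{2\rho_1}\|g^0-\nabla f(x^0)\|^2+\frac{\gamma A}{2\rho_1\rho_2}\sigma_0^2\right].$$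
   Context: $\|\cdot\|$ is the Euclidean norm on $\mathbb{R}^d$. A differentiable $f$ is $L$-smooth if $\|\nabla f(x)-\nabla f(y)\|\le L\|x-y\|$ for all $x,y$. Scheme: starting from $x^0$ with an initial estimator $g^0$, at each step $t$ a random variable $\xi_t$ is generated, an estimator $g^t=g^t(x^t,\xi_t,\text{history})\in\mathbb{R}^d$ of $\nabla f(x^t)$ is computed, and $x^{t+1}=x^t-\gamma_t g^t$. Let $\mathcal{F}_t=\sigma(x^0,\dots,x^t,\xi_1,\dots,\xi_{t-1})$. The estimator need not be unbiased. Unified Assumption: there are constants $A,B,C\ge0$, $\rho_1,\rho_2\in(0,1]$ and a (possibly random) non-negative sequence $\{\sigma_t^2\}_{t\ge0}$ such that for all $t\ge1$ $$\mathbb{E}\left[\|g^t-\nabla f(x^t)\|^2\mid\mathcal{F}_t\right]\le(1-\rho_1)\|g^{t-1}-\nabla f(x^{t-1})\|^2+A\sigma_{t-1}^2+BL^2\|x^t-x^{t-1}\|^2,$$ $$\mathbb{E}\left[\sigma_t^2\mid\mathcal{F}_t\right]\le(1-\rho_2)\sigma_{t-1}^2+CL^2\|x^t-x^{t-1}\|^2.$$ *)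

(* Defs.v *)
From HB Require Import structures.
From mathcomp Require Import all_boot all_order all_algebra.
From mathcomp Require Import all_classical all_reals all_analysis.
From mathcomp Require Import measurable_realfun.
Set Implicit Arguments.
Unset Strict Implicit.
Unset Printing Implicit Defensive.
Import Order.TTheory GRing.Theory Num.Theory.
Import numFieldNormedType.Exports.
Local Open Scope classical_set_scope.
Local Open Scope ring_scope.

(* The library norm `|v| on 'rV[R]_n is the sup norm, hence this definition;
   both norms induce the same topology, so [open] and [differentiable] below
   are the usual notions. *)
Definition enorm (R : realType) (n : nat) (v : 'rV[R]_n) : R :=
  Num.sqrt (\sum_(i < n) v ord0 i ^+ 2).

Definition grad (R : realType) (n : nat) (f : 'rV[R]_n -> R) (x : 'rV[R]_n) :
    'rV[R]_n :=
  \row_(i < n) 'D_(delta_mx ord0 i) f x.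

Definition smooth (R : realType) (n : nat) (L : R) (f : 'rV[R]_n -> R) : Prop :=
  (forall x, differentiable f x) /\
  (forall x y, enorm (grad f x - grad f y) <= L * enorm (x - y)).

Definition borel_rV (R : realType) (n : nat) : set (set 'rV[R]_n) :=
  <<s (@open 'rV[R]_n) >>.

Definition vmeasurable (R : realType) (n : nat) (Omega : Type)
    (F : set (set Omega)) (X : Omega -> 'rV[R]_n) : Prop :=
  forall B, borel_rV B -> F (X @^-1` B).

(* Y is a version of the conditional expectation E[X | F] of a nonnegative,
   not necessarily integrable, X; such a version always exists with values in
   [0, +oo] when F is a sub-sigma-algebra, and it is a.s. unique. *)
Definition is_cond_expectation (dO : measure_display)
    (Omega : measurableType dO) (R : realType) (P : probability Omega R)
    (F : set (set Omega)) (X Y : Omega -> \bar R) : Prop :=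
  [/\ forall w, (0 <= Y w)%E,
      forall B, measurable B -> F (Y @^-1` B) &
      forall A, F A -> (\int[P]_(w in A) Y w = \int[P]_(w in A) X w)%E].

Section Scheme.
Context (R : realType) (n : nat) (dO dXi : measure_display).
Context (Omega : measurableType dO) (Xi : measurableType dXi).
Context (P : probability Omega R).
Implicit Types (x g : nat -> Omega -> 'rV[R]_n) (xi : nat -> Omega -> Xi).

(* F_t = sigma(x^0, ..., x^t, xi_1, ..., xi_(t-1)) *)
Definition filtration x xi (t : nat) : set (set Omega) :=
  <<s \bigcup_(s in [set s | (s <= t)%N])
        preimage_set_system setT (x s) (@borel_rV R n) `|`
      \bigcup_(s in [set s | (1 <= s < t)%N])
        preimage_set_system setT (xi s) measurable >>.

(* Everything the estimator g^t may depend on: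
   sigma(x^0, ..., x^t, g^0, ..., g^(t-1), xi_1, ..., xi_t) *)
Definition history x g xi (t : nat) : set (set Omega) :=
  <<s \bigcup_(s in [set s | (s <= t)%N])
        preimage_set_system setT (x s) (@borel_rV R n) `|`
      \bigcup_(s in [set s | (s < t)%N])
        preimage_set_system setT (g s) (@borel_rV R n) `|`
      \bigcup_(s in [set s | (1 <= s <= t)%N])
        preimage_set_system setT (xi s) measurable >>.

(* The initial estimator g^0 is an arbitrary random vector, and the noise
   variables are xi_1, xi_2, ...; the value xi 0 is unused. *)
Record scheme (gamma_ : nat -> R) x g xi : Prop := Scheme {
  scheme_xi : forall t, (1 <= t)%N -> measurable_fun setT (xi t) ;
  scheme_x : forall t, vmeasurable measurable (x t) ;
  scheme_g : forall t, vmeasurable measurable (g t) ;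
  scheme_estimator : forall t, (1 <= t)%N ->
    vmeasurable (history x g xi t) (g t) ;
  scheme_step : forall t w, x t.+1 w = x t w - gamma_ t *: g t w
}.

(* [sigma2 t] stands for sigma_t^2. *)
Record unified_assumption (f : 'rV[R]_n -> R) (L A B C rho1 rho2 : R)
    (sigma2 : nat -> Omega -> R) x g xi : Prop := UnifiedAssumption {
  ua_A : 0 <= A ;
  ua_B : 0 <= B ;
  ua_C : 0 <= C ;
  ua_rho1 : 0 < rho1 <= 1 ;
  ua_rho2 : 0 < rho2 <= 1 ;
  ua_measurable : forall t, measurable_fun setT (sigma2 t) ;
  ua_ge0 : forall t w, 0 <= sigma2 t w ;
  ua_estimator : forall t, (1 <= t)%N ->
    exists2 Y : Omega -> \bar R,
      is_cond_expectation P (filtration x xi t)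
        (fun w => (enorm (g t w - grad f (x t w)) ^+ 2)%:E) Y &
      {ae P, forall w, (Y w <=
        ((1 - rho1) * enorm (g t.-1 w - grad f (x t.-1 w)) ^+ 2
         + A * sigma2 t.-1 w
         + B * L ^+ 2 * enorm (x t w - x t.-1 w) ^+ 2)%:E)%E} ;
  ua_sigma : forall t, (1 <= t)%N ->
    exists2 Y : Omega -> \bar R,
      is_cond_expectation P (filtration x xi t)
        (fun w => (sigma2 t w)%:E) Y &
      {ae P, forall w, (Y w <=
        ((1 - rho2) * sigma2 t.-1 w
         + C * L ^+ 2 * enorm (x t w - x t.-1 w) ^+ 2)%:E)%E}
}.

End Scheme.

(* Main.v *)
Require Import Defs.
From HB Require Import structures.
From mathcomp Require Import all_boot all_order all_algebra.
From mathcomp Require Import all_classical all_reals all_analysis.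
From mathcomp Require Import measurable_realfun.
From mathcomp Require Import ring lra.
Import Order.TTheory GRing.Theory Num.Theory.
Import numFieldNormedType.Exports.
Local Open Scope classical_set_scope.
Local Open Scope ring_scope.

(** Put [c_e = gamma / (2 rho1)], [c_s = gamma A / (2 rho1 rho2)] and
    [V_t = E[f (x^t) - f_* + c_e |g^t - grad f (x^t)|^2 + c_s sigma_t^2]]. The
    descent lemma for an [L]-smooth function gives, pointwise,
    [f (x^(t+1)) + gamma/2 |grad f (x^t)|^2 + (1/gamma - L)/2 |x^(t+1) - x^t|^2
     <= f (x^t) + gamma/2 |g^t - grad f (x^t)|^2].
    The weights are chosen so that adding [c_e] and [c_s] times the two
    recursions of the assumption reproduces [V_t], and the step size so that
    [(c_e B + c_s C) L^2 <= (1/gamma - L)/2] absorbs the terms in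
    [|x^(t+1) - x^t|^2]. Hence
    [gamma/2 E|grad f (x^t)|^2 + V_(t+1) <= V_t], which telescopes. Expectations
    are taken in [[0, +oo]], and the cancellations are only needed when [V_t]
    is finite. *)

Set Implicit Arguments.
Unset Strict Implicit.
Unset Printing Implicit Defensive.

(** * Euclidean norm and continuity of smooth functions *)

Lemma enorm_sqr (R : realType) (n : nat) (v : 'rV[R]_n) :
  enorm v ^+ 2 = \sum_(i < n) v ord0 i ^+ 2.
Proof. by rewrite sqr_sqrtr// sumr_ge0// => i _; rewrite sqr_ge0. Qed.

Lemma enorm0 (R : realType) (n : nat) : enorm (0 : 'rV[R]_n) = 0.
Proof. by rewrite /enorm big1 ?sqrtr0// => i _; rewrite mxE expr0n. Qed.

Lemma continuous_enorm (R : realType) (n : nat) : continuous (@enorm R n).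
Proof.
have sqr_cont : continuous (fun u : 'rV[R]_n => \sum_(i < n) u ord0 i ^+ 2).
  have addc : continuous (fun z : R * R => z.1 + z.2) by exact: add_continuous.
  apply: (@continuous_big R 'I_n +%R 0 xpredT addc 'rV[R]_n (index_enum _)
    (fun i (u : 'rV[R]_n) => u ord0 i ^+ 2)) => i _ u.
  by apply: continuousM; exact: coord_continuous.
move=> v; apply: continuous_comp; first exact: sqr_cont.
exact: sqrt_continuous.
Qed.

Lemma smooth_continuous (R : realType) (n : nat) (L : R) (f : 'rV[R]_n -> R) :
  smooth L f -> continuous f.
Proof. by move=> [df _] v; exact: differentiable_continuous. Qed.

(** A coordinate is bounded by the Euclidean norm, so it inherits the Lipschitz bound of the
    gradient. This is what makes the gradients along the iterates measurable. *)
Lemma smooth_continuous_grad (R : realType) (n : nat) (L : R)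
    (f : 'rV[R]_n -> R) (i : 'I_n) :
  0 < L -> smooth L f -> continuous (fun v => grad f v ord0 i).
Proof.
move=> L_gt0 [_ lipf].
have sub_cont (w u : 'rV[R]_n) :
    {for u, continuous (fun u' : 'rV[R]_n => enorm (w - u'))}.
  have cB : {for u, continuous (fun u' : 'rV[R]_n => w - u')}.
    by apply: continuousB; [exact: cst_continuous|exact: id].
  by apply: (continuous_comp cB); exact: continuous_enorm.
move=> v; apply/(cvgrPdist_lt (FF := nbhs_filter v)) => e e_gt0.
(* Euclidean closeness of [u] to [v] is drawn from the continuity of [enorm (v - u)] in [u]; the
   radius [e / L] makes the Lipschitz bound return [e]. *)
have /(cvgrPdist_lt (FF := nbhs_filter v))/(_ (e / L)) := sub_cont v v.
rewrite divr_gt0// => /(_ isT); apply: filterS => u.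
rewrite subrr enorm0 sub0r normrN ger0_norm ?sqrtr_ge0// => du.
apply: (@le_lt_trans _ _ (L * enorm (v - u))); last first.
  by rewrite mulrC -ltr_pdivlMr.
apply: le_trans (lipf v u).
rewrite -(@ler_pXn2r _ 2)// ?nnegrE ?sqrtr_ge0// real_normK ?num_real//.
by rewrite enorm_sqr (bigD1 i)//= !mxE lerDl sumr_ge0// => j _; rewrite sqr_ge0.
Qed.

(** * The descent lemma *)

Lemma diff_grad (R : realType) (n : nat) (f : 'rV[R]_n -> R) (x d : 'rV[R]_n) :
  differentiable f x ->
  'D_d f x = \sum_(i < n) grad f x ord0 i * d ord0 i.
Proof.
move=> df; rewrite deriveE// [in LHS](row_sum_delta d) linear_sum.
by apply: eq_bigr => i _; rewrite linearZ mxE -deriveE// mulrC.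
Qed.

(** Both difference quotients are the same function of [h], since
    [x + (s + h) d = h d + (x + s d)]. *)
Lemma is_derive_line (R : realType) (n : nat) (f : 'rV[R]_n -> R)
    (x d : 'rV[R]_n) (s : R) : differentiable f (x + s *: d) ->
  is_derive s 1 (fun r => f (x + r *: d)) ('D_d f (x + s *: d)).
Proof.
move=> df.
have E : (fun h : R => h^-1 *: (((fun r => f (x + r *: d)) \o shift s) (h *: 1)
            - f (x + s *: d))) =
         (fun h => h^-1 *: ((f \o shift (x + s *: d)) (h *: d)
            - f (x + s *: d))).
  apply/funext => h /=; congr (_ *: (f _ - _)).
  by rewrite scalerDl [_%:A]mulr1 addrCA.
by split; rewrite ?/derivable ?/derive E//; exact: diff_derivable.
Qed.

(* On the segment, [s |-> f (x + s d) - s <grad f x, d> - L s^2 |d|^2 / 2] is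
   nonincreasing, its derivative being
   [<grad f (x + s d) - grad f x, d> - L s |d|^2]. *)
Lemma descent (R : realType) (n : nat) (L : R) (f : 'rV[R]_n -> R)
    (x d : 'rV[R]_n) : 0 < L -> smooth L f ->
  f (x + d) <= f x + \sum_(i < n) grad f x ord0 i * d ord0 i
               + L / 2 * enorm d ^+ 2.
Proof.
move=> L_gt0 [df lipf].
set G := \sum_(i < n) _; set E := enorm d ^+ 2.
pose phi : R -> R := (fun s => f (x + s *: d)) -
  ((G \*: (@id R)) + ((L / 2 * E) \*: ((@id R) ^+ 2))).
have dphi (s : R) : is_derive s (1 : R) phi
    ('D_d f (x + s *: d) - (G + s * L * E)).
  have h1 := is_derive_line (df (x + s *: d)).
  apply: is_derive_eq.
  by rewrite /GRing.scale /=; field.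
(* The claim is [phi 1 <= phi 0]. *)
suff /(_ 1 0) : {in `[0, 1] &, {homo phi : a b /~ a <= b}}.
  rewrite !in_itv/= !lexx ler01 => /(_ isT isT).
  rewrite /phi !fctE /= scale1r scale0r addr0 /GRing.scale /= => /(_ isT).
  by rewrite !(expr1n, expr0n) /=; lra.
apply: ler0_derive1_le_cc.
- by move=> s _; exact: (@ex_derive _ _ _ _ _ _ _ (dphi s)).
- move=> s; rewrite in_itv /= => /andP[s_gt0 _].
  rewrite derive1E (@derive_val _ _ _ _ _ _ _ (dphi s)) diff_grad// /G.
  have Ls_gt0 : 0 < L * s by rewrite mulr_gt0.
  (* In place of Cauchy-Schwarz: after multiplication by [2 L s], expand [0 <= |D - L s d|^2] for
     [D = grad f (x + s d) - grad f x] and use [|D|^2 <= (L s |d|)^2]. *)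
  rewrite -(pmulr_rle0 _ (mulr_gt0 (ltr0n R 2) Ls_gt0)).
  have lip2 : enorm (grad f (x + s *: d) - grad f x) ^+ 2 <=
      (L * enorm (x + s *: d - x)) ^+ 2.
    by apply: lerXn2r (lipf _ _); rewrite nnegrE ?mulr_ge0 ?sqrtr_ge0 ?ltW.
  rewrite addrAC subrr add0r exprMn !enorm_sqr in lip2.
  rewrite /E enorm_sqr.
  have : 0 <= \sum_(i < n) ((grad f (x + s *: d) - grad f x) ord0 i
      - L * s * d ord0 i) ^+ 2 by rewrite sumr_ge0// => i _; rewrite sqr_ge0.
  have -> : \sum_(i < n) ((grad f (x + s *: d) - grad f x) ord0 i
      - L * s * d ord0 i) ^+ 2 =
    \sum_(i < n) (grad f (x + s *: d) - grad f x) ord0 i ^+ 2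
    + (L * s) ^+ 2 * \sum_(i < n) d ord0 i ^+ 2
    - 2 * (L * s) * (\sum_(i < n) grad f (x + s *: d) ord0 i * d ord0 i
       - \sum_(i < n) grad f x ord0 i * d ord0 i).
    rewrite -!sumrB !mulr_sumr -sumrN -!big_split /=; apply: eq_bigr => i _.
    by rewrite !mxE; ring.
  move: lip2; have -> : \sum_(i < n) (s *: d) ord0 i ^+ 2 =
      s ^+ 2 * \sum_(i < n) d ord0 i ^+ 2.
    by rewrite mulr_sumr; apply: eq_bigr => i _; rewrite mxE exprMn.
  by rewrite exprMn; lra.
- apply: continuous_subspaceT => s.
  have /derivable1_diffP := (@ex_derive _ _ _ _ _ _ _ (dphi s)).
  exact: differentiable_continuous.
Qed.

(** * Arithmetic of a single step *)

(** With [r] the square root, the left side is [gamma L^2 r^2 / 2] and the step size says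
    [gamma L (1 + r) <= 1]. Hence [(gamma L r)^2 <= (1 - gamma L)^2 <= 1 - gamma L], which is the
    claim times [2 gamma]. *)
Lemma step_size_bound (R : realType) (L A B C rho1 rho2 gamma : R) :
  0 < L -> 0 <= A -> 0 <= B -> 0 <= C -> 0 < rho1 -> 0 < rho2 -> 0 < gamma ->
  gamma <= L^-1 * (1 + Num.sqrt ((B * rho2 + A * C) / (rho1 * rho2)))^-1 ->
  gamma / (2 * rho1) * (B * L ^+ 2) + gamma * A / (2 * rho1 * rho2) * (C * L ^+ 2)
    <= (gamma^-1 - L) / 2.
Proof.
move=> L_gt0 A_ge0 B_ge0 C_ge0 rho1_gt0 rho2_gt0 gamma_gt0.
set K := (_ + A * C) / _; set r := Num.sqrt K => le_gamma.
have K_ge0 : 0 <= K.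
  by rewrite divr_ge0 ?addr_ge0 ?mulr_ge0 ?(ltW rho1_gt0) ?(ltW rho2_gt0).
have r_ge0 : 0 <= r by exact: sqrtr_ge0.
have u_le1 : gamma * L * (1 + r) <= 1.
  have r1_gt0 : 0 < 1 + r by lra.
  by move: le_gamma; rewrite -invfM -div1r ler_pdivlMr ?mulr_gt0// mulrA.
have -> : gamma / (2 * rho1) * (B * L ^+ 2)
    + gamma * A / (2 * rho1 * rho2) * (C * L ^+ 2) = gamma * L ^+ 2 * r ^+ 2 / 2.
  by rewrite sqr_sqrtr// /K; field; rewrite !gt_eqF.
rewrite ler_pM2r// -(ler_pM2l gamma_gt0) mulrBr divff ?gt_eqF//.
have u_gt0 : 0 < gamma * L by rewrite mulr_gt0.
have ur_ge0 : 0 <= gamma * L * r by rewrite mulr_ge0// ltW.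
have : (gamma * L * r) ^+ 2 <= (1 - gamma * L) ^+ 2.
  by rewrite lerXn2r// ?nnegrE//; lra.
nra.
Qed.

(** The descent lemma is applied to [d = - gamma g]. With [G = grad f x], expanding a square gives
    [<G, d> + gamma/2 |G|^2 + |d|^2 / (2 gamma) = gamma/2 |g - G|^2]. *)
Lemma gradient_step (R : realType) (n : nat) (L gamma : R) (f : 'rV[R]_n -> R)
    (x g : 'rV[R]_n) : 0 < L -> 0 < gamma -> smooth L f ->
  f (x - gamma *: g) + gamma / 2 * enorm (grad f x) ^+ 2
    + (gamma^-1 - L) / 2 * enorm (x - gamma *: g - x) ^+ 2
  <= f x + gamma / 2 * enorm (g - grad f x) ^+ 2.
Proof.
move=> L_gt0 gamma_gt0 smf; rewrite [x - _ - x]addrC addKr.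
have := descent x (- (gamma *: g)) L_gt0 smf.
rewrite !enorm_sqr => le_f.
suff : \sum_(i < n) grad f x ord0 i * (- (gamma *: g)) ord0 i
    + gamma / 2 * \sum_(i < n) grad f x ord0 i ^+ 2
    + gamma^-1 / 2 * \sum_(i < n) (- (gamma *: g)) ord0 i ^+ 2
  = gamma / 2 * \sum_(i < n) (g - grad f x) ord0 i ^+ 2 by lra.
rewrite !mulr_sumr -!big_split /=; apply: eq_bigr => i _.
by rewrite !mxE; field; rewrite gt_eqF.
Qed.

(** For finite values this is the sum of the three last hypotheses, where [d1] and [d2] cancel. If
    [a0], [e0] or [s0] is infinite, the right side is [+oo]; otherwise the hypotheses force all
    other values to be finite. *)
Lemma lyapunov_step_ereal (R : realType) (rho1 rho2 : R)
    (a0 a1 v d1 d2 e0 e1 s0 s1 : \bar R) :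
  (0 <= a0)%E -> (0 <= a1)%E -> (0 <= v)%E -> (0 <= d1)%E -> (0 <= d2)%E ->
  (0 <= e0)%E -> (0 <= e1)%E -> (0 <= s0)%E -> (0 <= s1)%E ->
  (a1 + v + d1 + d2 <= a0 + rho1%:E * e0)%E ->
  (e1 <= (1 - rho1)%:E * e0 + rho2%:E * s0 + d1)%E ->
  (s1 <= (1 - rho2)%:E * s0 + d2)%E ->
  (v + (a1 + e1 + s1) <= a0 + e0 + s0)%E.
Proof.
case: a0 => [a0| |]//; case: e0 => [e0| |]//; case: s0 => [s0| |]//;
  move=> a0_ge0; rewrite ?leey//.
case: a1 => [a1| |]//; case: v => [v| |]//;
  case: d1 => [d1| |]//; case: d2 => [d2| |]//.
case: e1 => [e1| |]//; case: s1 => [s1| |]//.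
by move=> _ _ _ _ _ _ _ _; rewrite -!EFinM -!EFinD !lee_fin; lra.
Qed.

(** * Expectations of nonnegative variables *)

Section expectation_nonneg.
Context (R : realType) (dO : measure_display) (Omega : measurableType dO).
Variable P : probability Omega R.
Implicit Types X Y Z : Omega -> R.

(** On this class the expectation is additive and monotone with values in [[0, +oo]], so
    integrability need not be tracked. *)
Definition nonneg_rv X : Prop :=
  measurable_fun setT X /\ forall w, 0 <= X w.

Lemma nonneg_rvD X Y : nonneg_rv X -> nonneg_rv Y ->
  nonneg_rv (fun w => X w + Y w).
Proof.
move=> [mX X0] [mY Y0]; split; first exact: measurable_funD.
by move=> w; rewrite addr_ge0.
Qed.

Lemma nonneg_rvZ (k : R) X : 0 <= k -> nonneg_rv X ->
  nonneg_rv (fun w => k * X w).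
Proof.
move=> k0 [mX X0]; split; first by apply: measurable_funM.
by move=> w; rewrite mulr_ge0.
Qed.

Lemma nonneg_expectation_ge0 X : nonneg_rv X -> (0 <= 'E_P[X])%E.
Proof. by move=> [_ X0]; exact: expectation_ge0. Qed.

Lemma nonneg_expectationD X Y : nonneg_rv X -> nonneg_rv Y ->
  ('E_P[fun w => (X w + Y w)%R] = 'E_P[X] + 'E_P[Y])%E.
Proof.
move=> [mX X0] [mY Y0]; rewrite unlock; under eq_integral do rewrite EFinD.
by rewrite ge0_integralD//; do ?[by move=> w _; rewrite lee_fin];
  exact/measurable_EFinP.
Qed.

Lemma nonneg_expectationZ (k : R) X : 0 <= k -> nonneg_rv X ->
  ('E_P[fun w => (k * X w)%R] = k%:E * 'E_P[X])%E.
Proof.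
move=> k0 [mX X0]; rewrite unlock; under eq_integral do rewrite EFinM.
by rewrite ge0_integralZl_EFin//; [move=> w _; rewrite lee_fin|
  exact/measurable_EFinP].
Qed.

Lemma nonneg_expectation_le X Y : nonneg_rv X -> nonneg_rv Y ->
  (forall w, X w <= Y w) -> ('E_P[X] <= 'E_P[Y])%E.
Proof.
move=> [mX X0] [mY Y0] XY; rewrite unlock; apply: ge0_le_integral => //;
  do ?[by move=> w _; rewrite lee_fin]; exact/measurable_EFinP.
Qed.

(** The whole space belongs to [F], so [Y] and [X] have the same integral over it, and the almost
    sure bound on [Y] can be integrated. *)
Lemma cond_expectation_le (F : set (set Omega)) X Z
    (Y : Omega -> \bar R) :
  F setT -> F `<=` measurable ->
  is_cond_expectation P F (fun w => (X w)%:E) Y ->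
  nonneg_rv Z ->
  {ae P, forall w, (Y w <= (Z w)%:E)%E} ->
  ('E_P[X] <= 'E_P[Z])%E.
Proof.
move=> FT Fm [Y0 mY EY] [mZ Z0] YZ; rewrite unlock -(EY _ FT).
apply: ae_ge0_le_integral => //.
- by move=> _ B mB; rewrite setTI; apply: Fm; exact: mY.
- by move=> w _; rewrite lee_fin.
- exact/measurable_EFinP.
- by apply: filterS YZ => w YZ _.
Qed.

End expectation_nonneg.

(** * Measurability along the scheme *)

Section scheme_measurability.
Context (R : realType) (n : nat) (dO dXi : measure_display).
Context (Omega : measurableType dO) (Xi : measurableType dXi).
Implicit Types (X : Omega -> 'rV[R]_n).

(** Open intervals generate the Borel sets of [R], and their preimages by [h] are open, hence in
    [borel_rV]. *)
Lemma measurable_continuous_comp X (h : 'rV[R]_n -> R) :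
  vmeasurable measurable X -> continuous h -> measurable_fun setT (h \o X).
Proof.
move=> mX /continuousP ch; apply: (measurability _ (RGenOpens.measurableE R)).
move=> _ [_ [a [b ->]] <-]; rewrite setTI comp_preimage; apply: mX.
by apply: sub_sigma_algebra; apply: ch; exact: itv_open.
Qed.

Lemma measurable_enorm_sqr X :
  (forall i, measurable_fun setT (fun w => X w ord0 i)) ->
  measurable_fun setT (fun w => enorm (X w) ^+ 2).
Proof.
move=> mX; under eq_fun do rewrite enorm_sqr.
by apply: measurable_sum => i; exact: measurable_funX.
Qed.

Lemma measurable_coord X (i : 'I_n) :
  vmeasurable measurable X -> measurable_fun setT (fun w => X w ord0 i).
Proof.
move=> mX; apply: (measurable_continuous_comp (h := fun v => v ord0 i) mX).
exact: coord_continuous.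
Qed.

Lemma filtration_setT (x : nat -> Omega -> 'rV[R]_n) (xi : nat -> Omega -> Xi) t :
  filtration x xi t setT.
Proof.
have [F0 FC _] := smallest_sigma_algebra setT (
      \bigcup_(s in [set s | (s <= t)%N])
        preimage_set_system setT (x s) (@borel_rV R n) `|`
      \bigcup_(s in [set s | (1 <= s < t)%N])
        preimage_set_system setT (xi s) measurable).
by rewrite -(setD0 setT); exact: FC.
Qed.

Lemma filtration_measurable (gamma_ : nat -> R)
    (x g : nat -> Omega -> 'rV[R]_n) (xi : nat -> Omega -> Xi) t :
  scheme gamma_ x g xi -> filtration x xi t `<=` measurable.
Proof.
move=> sch; apply: smallest_sub; first exact: sigma_algebra_measurable.
move=> _ [[s _ [B mB <-]]|[s /= /andP[s_gt0 _] [B mB <-]]].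
  by rewrite setTI; exact: (scheme_x sch).
exact: (scheme_xi sch).
Qed.

End scheme_measurability.

(** * The Lyapunov inequality and its summation *)

Ltac solve_nonneg_rv := by repeat first
  [ done
  | match goal with H : forall t, nonneg_rv _ |- _ => exact: H end
  | apply: nonneg_rvD | apply: nonneg_rvZ | apply: mulr_ge0 ].

Theorem theorem1 (R : realType) (n : nat) (dO dXi : measure_display)
    (Omega : measurableType dO) (Xi : measurableType dXi)
    (P : probability Omega R)
    (f : 'rV[R]_n -> R) (L A B C rho1 rho2 gamma : R)
    (x g : nat -> Omega -> 'rV[R]_n) (xi : nat -> Omega -> Xi)
    (sigma2 : nat -> Omega -> R)
    (L_gt0 : 0 < L) (f_smooth : smooth L f) (f_bounded : has_lbound (range f))
    (gamma_gt0 : 0 < gamma)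
    (xg_scheme : scheme (fun=> gamma) x g xi)
    (xg_unified : unified_assumption P f L A B C rho1 rho2 sigma2 x g xi)
    (gamma_le : gamma <=
      L^-1 * (1 + Num.sqrt ((B * rho2 + A * C) / (rho1 * rho2)))^-1)
    (T : nat) (T_gt0 : (0 < T)%N) :
  ((T%:R^-1)%:E * \sum_(t < T) 'E_P[fun w => (enorm (grad f (x t w)) ^+ 2)%R]
   <= (2 / (gamma * T%:R))%:E *
      'E_P[fun w => (f (x 0%N w) - inf (range f)
             + gamma / (2 * rho1) * enorm (g 0%N w - grad f (x 0%N w)) ^+ 2
             + gamma * A / (2 * rho1 * rho2) * sigma2 0%N w)%R])%E.
Proof.
have [A_ge0 B_ge0 C_ge0 /andP[rho1_gt0 rho1_le1] /andP[rho2_gt0 rho2_le1]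
  msigma sigma_ge0 ua_err ua_sig] := xg_unified.
have r1_ge0 := ltW rho1_gt0.
have r2_ge0 := ltW rho2_gt0.
have gamma_ge0 := ltW gamma_gt0.
pose Err t w := enorm (g t w - grad f (x t w)) ^+ 2.
pose Dx t w := enorm (x t.+1 w - x t w) ^+ 2.
pose Gr t w := enorm (grad f (x t w)) ^+ 2.
pose Fs t w := f (x t w) - inf (range f).
pose ce := gamma / (2 * rho1).
pose cs := gamma * A / (2 * rho1 * rho2).
have ce_ge0 : 0 <= ce by rewrite divr_ge0 ?mulr_ge0 ?ltW.
have cs_ge0 : 0 <= cs by rewrite divr_ge0 ?mulr_ge0.
have hg_ge0 : 0 <= gamma / 2 by rewrite divr_ge0 ?ltW.
have mx t i := measurable_coord i (scheme_x xg_scheme t).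
have mg t i := measurable_coord i (scheme_g xg_scheme t).
have mgrad t i : measurable_fun setT (fun w => grad f (x t w) ord0 i).
  apply: (measurable_continuous_comp (h := fun v => grad f v ord0 i)
    (scheme_x xg_scheme t)).
  exact: smooth_continuous_grad f_smooth.
have rvErr t : nonneg_rv (Err t).
  split=> [|w]; last by rewrite sqr_ge0.
  apply: measurable_enorm_sqr => i; under eq_fun do rewrite !mxE.
  apply: measurable_funB; first exact: mg.
  by have := mgrad t i; under eq_fun do rewrite mxE.
have rvDx t : nonneg_rv (Dx t).
  split=> [|w]; last by rewrite sqr_ge0.
  apply: measurable_enorm_sqr => i; under eq_fun do rewrite !mxE.
  by apply: measurable_funB; exact: mx.
have rvGr t : nonneg_rv (Gr t).
  split=> [|w]; last by rewrite sqr_ge0.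
  exact: measurable_enorm_sqr.
have rvFs t : nonneg_rv (Fs t).
  split=> [|w]; last by rewrite subr_ge0; apply: ge_inf => //; exists (x t w).
  apply: measurable_funB => //.
  apply: (measurable_continuous_comp (scheme_x xg_scheme t)).
  exact: smooth_continuous f_smooth.
have rvsig t : nonneg_rv (sigma2 t) by split.
have BL_ge0 : 0 <= B * L ^+ 2 by rewrite mulr_ge0// sqr_ge0.
have CL_ge0 : 0 <= C * L ^+ 2 by rewrite mulr_ge0// sqr_ge0.
have r1'_ge0 : 0 <= 1 - rho1 by rewrite subr_ge0.
have r2'_ge0 : 0 <= 1 - rho2 by rewrite subr_ge0.
pose V t : \bar R := ('E_P[Fs t] + 'E_P[fun w => (ce * Err t w)%R]
  + 'E_P[fun w => (cs * sigma2 t w)%R])%E.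
have step t : ('E_P[fun w => (gamma / 2 * Gr t w)%R] + V t.+1 <= V t)%E.
  (* The explicit terms are the displacement parts of the two recursions, scaled by [ce] and [cs].
     The other terms match because [rho1 * ce = gamma / 2] and [rho2 * cs = ce * A]. *)
  apply: (@lyapunov_step_ereal _ rho1 rho2 _ _ _
    'E_P[fun w => (ce * (B * L ^+ 2) * Dx t w)%R]%E
    'E_P[fun w => (cs * (C * L ^+ 2) * Dx t w)%R]%E); try by
    apply: nonneg_expectation_ge0; solve_nonneg_rv.
  - rewrite -nonneg_expectationZ; try solve_nonneg_rv.
    rewrite -!nonneg_expectationD; try solve_nonneg_rv.
    apply: nonneg_expectation_le; try solve_nonneg_rv.
    move=> w; have := gradient_step (x t w) (g t w) L_gt0 gamma_gt0 f_smooth.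
    rewrite -(scheme_step xg_scheme) -/(Err t w) -/(Gr t w) -/(Dx t w) => desc.
    (* Multiplied by [Dx t w], this bound lets the quadratic gain of the descent pay for both
       displacement terms. *)
    have := step_size_bound L_gt0 A_ge0 B_ge0 C_ge0 rho1_gt0 rho2_gt0 gamma_gt0
      gamma_le.
    rewrite -/ce -/cs => /(ler_wpM2r ((rvDx t).2 w)).
    have -> : rho1 * (ce * Err t w) = gamma / 2 * Err t w.
      by rewrite /ce; field; rewrite gt_eqF.
    by rewrite /Fs; lra.
  (* The recursions start at index 1; at [t.+1] their right sides involve step [t] and the
     displacement [Dx t]. *)
  - have [Y condY leY] := ua_err t.+1 isT.
    rewrite -!nonneg_expectationZ; try solve_nonneg_rv.
    rewrite -!nonneg_expectationD; try solve_nonneg_rv.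
    have rvZ : nonneg_rv (fun w => (1 - rho1) * Err t w + A * sigma2 t w
        + B * L ^+ 2 * Dx t w).
      solve_nonneg_rv.
    have := cond_expectation_le (@filtration_setT _ _ _ _ _ _ x xi t.+1)
      (filtration_measurable (t := t.+1) xg_scheme) condY rvZ leY.
    move=> /(lee_wpmul2l (_ : (0 <= ce%:E)%E)); rewrite lee_fin => /(_ ce_ge0).
    rewrite -!nonneg_expectationZ; try solve_nonneg_rv.
    move=> /le_trans; apply.
    rewrite le_eqVlt; apply/orP; left; apply/eqP; congr expectation.
    apply/funext => w; rewrite /cs /ce; field.
    by rewrite !gt_eqF.
  - have [Y condY leY] := ua_sig t.+1 isT.
    rewrite -!nonneg_expectationZ; try solve_nonneg_rv.
    rewrite -!nonneg_expectationD; try solve_nonneg_rv.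
    have rvZ : nonneg_rv (fun w => (1 - rho2) * sigma2 t w
        + C * L ^+ 2 * Dx t w).
      solve_nonneg_rv.
    have := cond_expectation_le (@filtration_setT _ _ _ _ _ _ x xi t.+1)
      (filtration_measurable (t := t.+1) xg_scheme) condY rvZ leY.
    move=> /(lee_wpmul2l (_ : (0 <= cs%:E)%E)); rewrite lee_fin => /(_ cs_ge0).
    rewrite -!nonneg_expectationZ; try solve_nonneg_rv.
    move=> /le_trans; apply.
    rewrite le_eqVlt; apply/orP; left; apply/eqP; congr expectation.
    by apply/funext => w; ring.
(* Keeping [V m] on the left avoids subtracting possibly infinite expectations. *)
have telescope m :
    (\sum_(t < m) 'E_P[fun w => (gamma / 2 * Gr t w)%R] + V m <= V 0%N)%E.
  elim: m => [|m IH]; first by rewrite big_ord0 add0e.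
  rewrite big_ord_recr /= -addeA; apply: le_trans IH.
  by rewrite leeD2l.
have V_ge0 t : (0 <= V t)%E.
  by rewrite !adde_ge0//; apply: nonneg_expectation_ge0; solve_nonneg_rv.
have T_gt0' : 0 < T%:R :> R by rewrite ltr0n.
have -> : 'E_P[fun w => (f (x 0%N w) - inf (range f)
      + gamma / (2 * rho1) * enorm (g 0%N w - grad f (x 0%N w)) ^+ 2
      + gamma * A / (2 * rho1 * rho2) * sigma2 0%N w)%R]%E = V 0%N.
  rewrite /V -!nonneg_expectationD//; solve_nonneg_rv.
have : (\sum_(t < T) 'E_P[fun w => (gamma / 2 * Gr t w)%R] <= V 0%N)%E.
  by apply: le_trans (telescope T); rewrite leeDl.
under eq_bigr do rewrite nonneg_expectationZ//.
rewrite -ge0_sume_distrr; last first.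
  by move=> t _; exact: nonneg_expectation_ge0.
(* The factor [2 / (gamma T)] turns the weight [gamma / 2] of the sum into [1 / T]. *)
move=> /(lee_wpmul2l (_ : (0 <= (2 / (gamma * T%:R))%:E)%E)).
rewrite lee_fin divr_ge0 ?mulr_ge0 ?(ltW gamma_gt0)// => /(_ isT).
rewrite muleA -EFinM; congr (_ * _ <= _)%E; congr EFin.
by field; rewrite !gt_eqF.
Qed.
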